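(* If the inflation functional equation $\psi(\mathcal{X})=\mathcal{X}$ with primitive subdivision matrix $S=[|\mathcal{D}_{ij}|]_{1\le i,j\le n}$ has a solution $\mathcal{X}$ that is a weak Delone multiset family, then the Perron eigenvalue $\lambda(S)$ of $S$ satisfies $$\lambda(S)=|\det(A)|.$$
   Context: Fix integers $d,n\ge 1$, an expanding real $d\times d$ matrix $A$ (all eigenvalues, real or complex, have absolute value $>1$), and finite, possibly empty, sets $\mathcal{D}_{ij}\subset\mathbb{R}^d$ for $1\le i,j\le n$. A multiset $X$ in $\mathbb{R}^d$ is a set $\underline{X}\subset\mathbb{R}^d$ (the underlying set) with a multiplicity function $m_X:\underline{X}\to\mathbb{Z}_{>0}$, extended by $m_X(\mathbf{x})=0$ for $\mathbf{x}\notin\underline{X}$. The multiset union $X\vee Y$ has multiplicity function $m_X+m_Y$. $A(X)$ has multiplicity $m_X(A^{-1}\mathbf{x})$ at $\mathbf{x}$, and $X+\mathcal{D}=\bigvee_{\mathbf{d}\in\mathcal{D}}(X+\mathbf{d})$. A multiset family is a vector $\mathcal{X}=(X_1,\dots,X_n)$ of multisets in $\mathbb{R}^d$. The inflation operator is $\psi(\mathcal{X})=(X_1',\dots,X_n')$ with $X_i'=\bigvee_{j=1}^n(A(X_j)+\mathcal{D}_{ij})$. A nonnegative real square matrix is primitive if some power has all entries strictly positive; its Perron eigenvalue $\lambda(\cdot)$ is its positive real simple eigenvalue equal to its spectral radius. A multiset $X$ is weakly uniformly discrete if there are $r>0$ and a finite $m\ge 1$ such that any open ball of radius $r$ contains at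 most $m$ points of $X$, counted with multiplicity. It is relatively dense if there is a finite $R>0$ such that each closed ball of radius $R$ contains at least one point of $X$. It is a weak Delone multiset if it is weakly uniformly discrete and relatively dense. A weak Delone multiset family is a multiset family satisfying the inflation functional equation such that each $X_i$ is a weak Delone multiset. *)

(* Defs.v *)
From HB Require Import structures.
From mathcomp Require Import all_boot all_order all_algebra.
From mathcomp Require Import finmap.
From mathcomp Require Import all_classical all_reals all_analysis.
From mathcomp Require Import complex.

Set Implicit Arguments.
Unset Strict Implicit.
Unset Printing Implicit Defensive.

Import Order.TTheory GRing.Theory Num.Theory.

Local Open Scope classical_set_scope.
Local Open Scope ring_scope.
Local Open Scope complex_scope.

Definition complexify (R : realType) (k : nat) (M : 'M[R]_k) : 'M[R[i]]_k :=
  map_mx (real_complex R) M.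

Definition complex_eigenvalue (R : realType) (k : nat) (M : 'M[R]_k)
    (z : R[i]) : Prop :=
  eigenvalue (complexify M) z.

Definition expanding (R : realType) (d : nat) (A : 'M[R]_d) : Prop :=
  forall z : R[i], complex_eigenvalue A z -> 1 < `|z|.

Definition primitive_mx (R : realType) (n : nat) (S : 'M[R]_n) : Prop :=
  (forall i j, 0 <= S i j) /\
  exists2 k : nat, (0 < k)%N & forall i j, 0 < (S ^+ k) i j.

(* The norm of R[i] takes values in R[i]; it is read back in R through Re. *)
Definition spectral_radius (R : realType) (n : nat) (S : 'M[R]_n) : R :=
  sup [set complex.Re `|z| | z in complex_eigenvalue S].

(* "Simple" means of algebraic multiplicity one. *)
Definition is_perron_eigenvalue (R : realType) (n : nat) (S : 'M[R]_n)
    (l : R) : Prop :=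
  [/\ 0 < l, eigenvalue S l, mup l (char_poly S) = 1%N
    & l = spectral_radius S].

(* There is at most one Perron eigenvalue, and by Perron-Frobenius there is one
   when [S] is primitive; the junk value 0 is never a Perron eigenvalue. *)
Definition perron_eigenvalue (R : realType) (n : nat) (S : 'M[R]_n) : R :=
  xget 0 [set l | is_perron_eigenvalue S l].

(* The library norm on matrices is the sup norm; the balls here are
   Euclidean. *)
Definition enorm (R : realType) (d : nat) (v : 'cV[R]_d) : R :=
  Num.sqrt (\sum_(i < d) v i 0 ^+ 2).

(* A multiset is given by its multiplicity function extended by 0; the
   underlying set is the support of that function. *)
Definition multiset (R : realType) (d : nat) : Type := 'cV[R]_d -> nat.

Definition underlying (R : realType) (d : nat) (X : multiset R d) :
    set 'cV[R]_d :=
  [set x | (0 < X x)%N].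

(* [A] is meant to be invertible, which holds for expanding matrices. *)
Definition mset_image (R : realType) (d : nat) (A : 'M[R]_d)
    (X : multiset R d) : multiset R d :=
  fun x => X (invmx A *m x).

Definition mset_translate (R : realType) (d : nat) (X : multiset R d)
    (v : 'cV[R]_d) : multiset R d :=
  fun x => X (x - v).

(* Multiset union adds multiplicities, hence the sums below. *)
Definition mset_add (R : realType) (d : nat) (X : multiset R d)
    (D : {fset 'cV[R]_d}) : multiset R d :=
  fun x => (\sum_(v <- D) mset_translate X v x)%N.

Definition inflation (R : realType) (d n : nat) (A : 'M[R]_d)
    (D : 'I_n -> 'I_n -> {fset 'cV[R]_d}) (X : 'I_n -> multiset R d) :
    'I_n -> multiset R d :=
  fun i x => (\sum_(j < n) mset_add (mset_image A (X j)) (D i j) x)%N.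

Definition subdivision_mx (R : realType) (d n : nat)
    (D : 'I_n -> 'I_n -> {fset 'cV[R]_d}) : 'M[R]_n :=
  \matrix_(i < n, j < n) (#|` D i j|)%:R.

(* The [esum] counts the points of [X] in the open ball with multiplicity. *)
Definition weakly_uniformly_discrete (R : realType) (d : nat)
    (X : multiset R d) : Prop :=
  exists2 r : R, 0 < r &
  exists2 m : nat, (1 <= m)%N &
  forall c : 'cV[R]_d,
    (\esum_(x in [set x | (enorm (x - c) < r)%R]) ((X x)%:R)%:E
       <= (m%:R : R)%:E)%E.

Definition relatively_dense (R : realType) (d : nat) (X : multiset R d) :
    Prop :=
  exists2 r : R, 0 < r &
  forall c : 'cV[R]_d, exists2 x, underlying X x & enorm (x - c) <= r.

Definition weak_Delone (R : realType) (d : nat) (X : multiset R d) : Prop :=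
  weakly_uniformly_discrete X /\ relatively_dense X.

Definition weak_Delone_family (R : realType) (d n : nat) (A : 'M[R]_d)
    (D : 'I_n -> 'I_n -> {fset 'cV[R]_d}) (X : 'I_n -> multiset R d) : Prop :=
  inflation A D X = X /\ forall i, weak_Delone (X i).

(* Main.v *)
Require Import Defs.
From HB Require Import structures.
From mathcomp Require Import all_boot all_order all_algebra.
From mathcomp Require Import finmap.
From mathcomp Require Import all_classical all_reals all_analysis.
From mathcomp Require Import complex.
From mathcomp Require Import perm ring lra.

Set Implicit Arguments.
Unset Strict Implicit.
Unset Printing Implicit Defensive.

Import Order.TTheory GRing.Theory Num.Theory.

Local Open Scope ring_scope.

(** Why the theorem holds.  Write [S] for the subdivision matrix, [M] for the
    inverse of [A], [delta] for [|det A|], and let [F k rho] be the image under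
    [A^k] of the cube of half-side [rho], that is, the set of the [x] such that
    all entries of [M^k x] are at most [rho] in absolute value.  The points of
    the [X_i] in [F k rho], counted with multiplicity, can be estimated in two
    ways as [k] grows.

    By geometry, their number is of order [delta^k]: at most a constant number
    of points lies in each cell of a fine cubic grid, at least one lies near
    each point of a coarse one, and the number of integer points in [F k rho]
    is of order [delta^k] ([discrete_count_upper], [dense_count_lower]).  The
    count of integer points ([lattice_count_upper], [lattice_count_lower])
    replaces a comparison of volumes: Gaussian elimination with partial pivoting,
    whose multipliers are at most 1, peels off one coordinate at a time, and the
    product of the pivots is the determinant up to sign.

    By the inflation equation, the count of [X_i] in [F (k+1) rho] is bounded
    from both sides by [sum_j S_ij] times the count of [X_j] in
    [F k (rho +- e)], where [e] bounds the entries of [M^(k+1) v] over the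
    digits [v].  As [A] is expanding, these errors are summable over [k], so
    that the counts on level [k] are bounded by [S^k] applied to counts on
    level 0 in cubes of bounded size ([count_le_iter], [count_ge_iter]).
    Weighing them with a positive left eigenvector of [S] for the Perron
    eigenvalue [l] turns [S^k] into [l^k].

    So [l^k] and [delta^k] agree up to constant factors, and [l = delta].

    Two facts of matrix theory are needed.  Powers of a matrix whose complex
    eigenvalues lie in the open unit disc have absolutely summable entries;
    this follows from the Cayley-Hamilton theorem by removing one linear factor
    of the characteristic polynomial at a time
    ([contracting_power_sums_bounded]).  A primitive matrix has a Perron
    eigenvalue with a positive left eigenvector ([perron_frobenius]): the
    moduli of the entries of an eigenvector for an eigenvalue of maximal modulus
    form a subinvariant vector, and by primitivity a strictly subinvariant vector
    would grow faster than the spectral radius allows. *)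

(** * Powers of contracting matrices *)

(** Summing [a (k+1) <= q a k + b k] over [k] bounds the partial sums of [a] in
    terms of themselves, with the factor [q < 1]. *)
Lemma affine_recursion_sums_bounded (C : numDomainType) (q B : C) (a b : nat -> C) :
  0 <= q < 1 -> (forall k, 0 <= a k) ->
  (forall k, a k.+1 <= q * a k + b k) ->
  (forall K, \sum_(k < K) b k <= B) ->
  forall K, (1 - q) * \sum_(k < K) a k <= a 0%N + B.
Proof.
move=> /andP[q0 q1] a0 ab bB K.
have B0 : 0 <= B by have := bB 0%N; rewrite big_ord0.
case: K => [|K]; first by rewrite big_ord0 mulr0 addr_ge0.
have step : \sum_(k < K.+1) a k <= a 0%N + q * \sum_(k < K.+1) a k + B.
  rewrite {1}big_ord_recl -addrA lerD2l.
  apply: (@le_trans _ _ (\sum_(k < K) (q * a k + b k))).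
    by apply: ler_sum => k _; apply: ab.
  rewrite big_split /= -mulr_sumr lerD ?bB// ler_wpM2l//.
  by rewrite big_ord_recr lerDl.
rewrite mulrBl mul1r lerBlDr; apply: le_trans step _.
by rewrite addrAC.
Qed.

(** Induction on the factors: [(M - z) P] is killed by the remaining ones, so
    its orbit is summable, and the orbit of [P] satisfies the recursion
    [M^(k+1) P = z M^k P + M^k (M - z) P] with [|z| < 1]. *)
Lemma annihilated_orbit_sums_bounded (C : numFieldType) (m : nat) (M : 'M[C]_m.+1)
    (rs : seq C) (P : 'M[C]_m.+1) :
  (forall z, z \in rs -> `|z| < 1) ->
  horner_mx M (\prod_(z <- rs) ('X - z%:P)) * P = 0 ->
  forall i j, exists B : C, forall K, \sum_(k < K) `|(M ^+ k * P) i j| <= B.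
Proof.
elim: rs P => [|z rs IH] P rs1 P0 i j.
  exists 0 => K; rewrite big1// => k _.
  by move: P0; rewrite big_nil rmorph1 mul1r => ->; rewrite mulr0 mxE normr0.
have [||B BP] := IH ((M - z%:M) * P) _ _ i j.
- by move=> y ys; apply: rs1; rewrite in_cons ys orbT.
- rewrite -P0 big_cons mulrC rmorphM/= mulrA; congr (_ * _ * _).
  by rewrite rmorphB/= horner_mx_X horner_mx_C.
have z1 : 0 <= `|z| < 1 by rewrite normr_ge0 rs1// mem_head.
exists ((`|(M ^+ 0 * P) i j| + B) / (1 - `|z|)) => K.
have z1' : 0 < 1 - `|z| by rewrite subr_gt0; case/andP: z1.
rewrite ler_pdivlMr// mulrC.
apply: (affine_recursion_sums_bounded (a := fun k => `|(M ^+ k * P) i j|)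
  (b := fun k => `|(M ^+ k * ((M - z%:M) * P)) i j|) _ _ _ BP) => // k.
have -> : M ^+ k.+1 * P = z *: (M ^+ k * P) + M ^+ k * ((M - z%:M) * P).
  rewrite exprSr -mulrA mulrBl mulrBr (mul_scalar_mx z P : z%:M * P = _) -scalerAr addrC.
  by rewrite subrK.
set Q := M ^+ k * P; set Q' := M ^+ k * _.
by rewrite mxE [(z *: Q) i j]mxE (le_trans (ler_normD _ _))// normrM.
Qed.

Lemma contracting_power_sums_bounded (C : numClosedFieldType) (m : nat)
    (M : 'M[C]_m.+1) :
  (forall z, eigenvalue M z -> `|z| < 1) ->
  forall i j, exists B : C, forall K, \sum_(k < K) `|(M ^+ k) i j| <= B.
Proof.
move=> M1 i j.
have [rs rsE] := closed_field_poly_normal (char_poly M).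
rewrite (monicP (char_poly_monic M)) scale1r in rsE.
have [||B HB] := @annihilated_orbit_sums_bounded _ _ M rs 1 _ _ i j.
- by move=> z zs; apply: M1; rewrite eigenvalue_root_char rsE root_prod_XsubC.
- by rewrite -rsE Cayley_Hamilton mul0r.
by exists B => K; under eq_bigr => k do rewrite -[M ^+ k]mulr1.
Qed.

Lemma complexify_power (R : realType) (m : nat) (M : 'M[R]_m.+1) k :
  complexify (M ^+ k) = complexify M ^+ k.
Proof. exact: rmorphXn. Qed.

Lemma real_contracting_power_sums_bounded (R : realType) (m : nat) (M : 'M[R]_m.+1) :
  (forall z, complex_eigenvalue M z -> `|z| < 1) ->
  forall i j, exists B : R, forall K, \sum_(k < K) `|(M ^+ k) i j| <= B.
Proof.
move=> M1 i j.
have [B HB] := contracting_power_sums_bounded M1 i j.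
exists (complex.Re B) => K.
have := HB K.
under eq_bigr => k do rewrite -complexify_power mxE normc_def/= expr0n/= addr0 sqrtr_sqr.
by rewrite -rmorph_sum/= lecE/= => /andP[].
Qed.
(** * Perron-Frobenius theorem for primitive matrices *)
Lemma sub_scale_mxE (R : comPzRingType) (m n : nat) (u v : 'M[R]_(m, n)) c i j :
  (u - c *: v) i j = u i j - c * v i j.
Proof. by rewrite !mxE. Qed.

Lemma ler_mulmx_nonneg (R : realType) (m n : nat) (u v : 'rV[R]_m) (S : 'M[R]_(m, n)) :
  (forall i j, 0 <= S i j) -> (forall i, u 0 i <= v 0 i) ->
  forall j, (u *m S) 0 j <= (v *m S) 0 j.
Proof. by move=> S0 uv j; rewrite !mxE ler_sum// => i _; rewrite ler_wpM2r. Qed.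

Lemma left_eigenvector_power (R : realType) (n : nat) (S : 'M[R]_n.+1) (l : R)
    (p : 'rV[R]_n.+1) k :
  p *m S = l *: p -> p *m S ^+ k = l ^+ k *: p.
Proof.
move=> pS; elim: k => [|k IH]; first by rewrite !expr0 mulmx1 scale1r.
by rewrite exprSr mulmxA IH -scalemxAl pS scalerA exprSr.
Qed.

Lemma pos_mulmx_pos (R : realType) (m n : nat) (v : 'rV[R]_m) (S : 'M[R]_(m, n)) :
  (forall i j, 0 < S i j) -> (forall i, 0 <= v 0 i) -> v != 0 ->
  forall j, 0 < (v *m S) 0 j.
Proof.
move=> S0 v0 /rV0Pn[i vi] j.
rewrite mxE (bigD1 i)//= ltr_wpDr//; last by rewrite mulr_gt0// lt_def vi v0.
by apply: sumr_ge0 => k _; rewrite mulr_ge0// ltW.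
Qed.

Lemma bounded_multiples_le0 (R : realType) (a T : R) :
  (forall K : nat, K%:R * a <= T) -> a <= 0.
Proof.
move=> aT; rewrite leNgt; apply/negP => a0.
have := aT (Num.bound `|T / a|).
rewrite -ler_pdivlMr// leNgt => /negP; apply.
by rewrite (le_lt_trans (ler_norm _))// archi_boundP.
Qed.

Lemma complex_eigenvalue_scale (R : realType) (n : nat) (S : 'M[R]_n) (t : R) z :
  t != 0 -> complex_eigenvalue (t^-1 *: S) z ->
  complex_eigenvalue S (t%:C%C * z).
Proof.
move=> t0 /eigenvalueP[v vS v0]; apply/eigenvalueP; exists v => //.
have tC : t%:C%C != 0 by rewrite -(rmorph0 (real_complex R)) (inj_eq (@complexI _)).
rewrite -scalerA -vS /complexify map_mxZ -scalemxAr scalerA fmorphV divff//.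
by rewrite scale1r.
Qed.

(** Iterating the hypothesis gives [w <= w (S / t)^k] for all [k], while the powers
    of the contracting matrix [S / t] are summable. *)
Lemma subinvariant_eq0 (R : realType) (n : nat) (S : 'M[R]_n.+1) (t : R)
    (w : 'rV[R]_n.+1) :
  (forall i j, 0 <= S i j) -> 0 < t ->
  (forall z, complex_eigenvalue S z -> `|z| < t%:C%C) ->
  (forall j, 0 <= w 0 j) -> (forall j, t * w 0 j <= (w *m S) 0 j) -> w = 0.
Proof.
move=> S0 t0 St w0 wS; pose M := t^-1 *: S.
have M0 i j : 0 <= M i j by rewrite mxE mulr_ge0// invr_ge0 ltW.
have tC : 0 < t%:C%C :> R[i]%C by rewrite ltcR.
have M1 z : complex_eigenvalue M z -> `|z| < 1.
  move=> /(complex_eigenvalue_scale (lt0r_neq0 t0))/St.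
  by rewrite normrM (gtr0_norm tC) gtr_pMr.
have wM k j : w 0 j <= (w *m M ^+ k) 0 j.
  elim: k j => [|k IH] j; first by rewrite expr0 mulmx1.
  rewrite exprSr mulmxA; apply: le_trans (ler_mulmx_nonneg M0 IH j).
  by rewrite -scalemxAr mxE ler_pdivlMl.
apply/rowP => i; rewrite [RHS]mxE; apply/eqP; rewrite eq_le w0 andbT.
have /choice[B BP] := fun j => real_contracting_power_sums_bounded M1 j i.
apply: (@bounded_multiples_le0 _ _ (\sum_j w 0 j * B j)) => K.
apply: (@le_trans _ _ (\sum_(k < K) \sum_j w 0 j * `|(M ^+ k) j i|)).
  rewrite mulr_natl -[K in _ *+ K]card_ord -sumr_const ler_sum// => k _.
  rewrite (le_trans (wM k i))// mxE ler_sum// => j _.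
  by rewrite ler_wpM2l// ler_norm.
rewrite exchange_big ler_sum//= => j _.
rewrite -mulr_sumr; apply: ler_wpM2l => //; exact: BP.
Qed.

Lemma dominating_scalar (R : realType) (n : nat) (x y : 'rV[R]_n) :
  (forall j, 0 <= x 0 j) -> (forall j, 0 < y 0 j) ->
  exists2 e : R, 0 < e & forall j, e * x 0 j <= y 0 j.
Proof.
move=> x0 y0.
have q0 j : 0 <= x 0 j / y 0 j by rewrite divr_ge0// ltW.
have s0 : 0 < 1 + \sum_j x 0 j / y 0 j by rewrite ltr_pwDl// sumr_ge0.
exists (1 + \sum_j x 0 j / y 0 j)^-1; first by rewrite invr_gt0.
move=> j; rewrite ler_pdivrMl// -ler_pdivrMr// (bigD1 j)//= addrCA lerDl.
by rewrite addr_ge0// sumr_ge0.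
Qed.

(** If [w S - t w] were nonzero, a positive power [S^k] would map it to a
    positive vector, so [w S^k] would satisfy the strict inequality with a
    factor [t + e > t], contradicting [subinvariant_eq0]. *)
Lemma subinvariant_eigenvector (R : realType) (n : nat) (S : 'M[R]_n.+1) (t : R)
    (w : 'rV[R]_n.+1) :
  primitive_mx S -> 0 <= t ->
  (forall z, complex_eigenvalue S z -> `|z| <= t%:C%C) ->
  (forall j, 0 <= w 0 j) -> (forall j, t * w 0 j <= (w *m S) 0 j) ->
  w *m S = t *: w.
Proof.
move=> [S0 [k k0 Sk]] t0 St w0 wS; apply/eqP; rewrite -subr_eq0.
apply: contraT => y0; pose y := w *m S - t *: w; pose x := w *m S ^+ k.
have Sk0 i j : 0 <= (S ^+ k) i j by rewrite ltW.
have y'0 j : 0 < (y *m S ^+ k) 0 j.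
  by apply: pos_mulmx_pos => // i; rewrite sub_scale_mxE subr_ge0.
have x0 j : 0 <= x 0 j by rewrite mxE sumr_ge0// => i _; rewrite mulr_ge0.
have xyE : y *m S ^+ k = x *m S - t *: x.
  rewrite mulmxBl -scalemxAl -/x; congr (_ - _).
  by rewrite -!mulmxA; congr (_ *m _); exact: (commrX k (commr_refl S)).
have [e e0 ex] := dominating_scalar x0 y'0.
have xz : x = 0.
  apply: (@subinvariant_eq0 _ _ S (t + e)) => //.
  - by rewrite ltr_wpDl.
  - by move=> z /St /le_lt_trans; apply; rewrite ltcR ltrDl.
  - move=> j; have := ex j; rewrite xyE.
    by rewrite sub_scale_mxE lerBrDl mulrDl.
have := y'0 0.
by rewrite xyE xz mul0mx scaler0 subrr mxE ltxx.
Qed.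
Section PerronVector.
Variables (R : realType) (n : nat) (S : 'M[R]_n.+1) (l : R) (p : 'rV[R]_n.+1).
Hypothesis S_primitive : primitive_mx S.
Hypothesis l_gt0 : 0 < l.
Hypothesis p_gt0 : forall j, 0 < p 0 j.
Hypothesis pS : p *m S = l *: p.

Lemma dot_pos_eq0 (y : 'cV[R]_n.+1) :
  (forall i, 0 <= y i 0) -> p *m y = 0 -> y = 0.
Proof.
move=> y0 /matrixP/(_ 0 0); rewrite !mxE => /eqP.
rewrite psumr_eq0; last by move=> i _; rewrite mulr_ge0// ltW.
move=> /allP py; apply/colP => i; rewrite mxE.
have := py i; rewrite mem_index_enum /= mulf_eq0 gt_eqF//= => /(_ isT)/eqP.
by [].
Qed.

(** The positive part [y] of [x] satisfies [S y >= l y]; pairing with [p] forces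
    equality, so [y] is zero or, by primitivity, positive.  In the second case
    [x = y] is positive, which is incompatible with [p x = 0]. *)
Lemma orthogonal_eigenvector_le0 (x : 'cV[R]_n.+1) :
  S *m x = l *: x -> p *m x = 0 -> forall i, x i 0 <= 0.
Proof.
move=> Sx px; case: S_primitive => S0 [k k0 Sk].
pose y : 'cV[R]_n.+1 := \col_i Num.max (x i 0) 0.
have y0 i : 0 <= y i 0 by rewrite mxE le_max lexx orbT.
have xy i : x i 0 <= y i 0 by rewrite mxE le_max lexx.
have Sy : S *m y = l *: y.
  apply/eqP; rewrite -subr_eq0; apply/eqP/dot_pos_eq0; last first.
    by rewrite mulmxBr mulmxA pS -scalemxAl -scalemxAr subrr.
  move=> i; rewrite sub_scale_mxE subr_ge0.
  rewrite [X in _ * X]mxE (maxr_pMr _ _ (ltW l_gt0)) mulr0 ge_max; apply/andP; split.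
    have /matrixP/(_ i 0) := Sx; rewrite [RHS]mxE => <-.
    by rewrite !mxE ler_sum// => j _; rewrite ler_wpM2l.
  by rewrite mxE sumr_ge0// => j _; rewrite mulr_ge0.
have Sky : S ^+ k *m y = l ^+ k *: y.
  elim: (k) => [|m IH]; first by rewrite !expr0 mul1mx scale1r.
  by rewrite exprS -mulmxA IH -scalemxAr Sy scalerA exprSr.
have [y_eq0|yn0] := eqVneq y 0.
  by move=> i; rewrite (le_trans (xy i))// y_eq0 mxE.
have ypos i : 0 < y i 0.
  rewrite -(pmulr_rgt0 _ (exprn_gt0 k l_gt0)).
  have -> : l ^+ k * y i 0 = (y^T *m (S ^+ k)^T) 0 i.
    by rewrite -trmx_mul Sky !mxE.
  apply: pos_mulmx_pos => [a b|a|]; [by rewrite mxE|by rewrite mxE|].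
  by apply: contraNN yn0 => /eqP yt; rewrite -[y]trmxK yt trmx0.
have x0 i : 0 < x i 0.
  by have := ypos i; rewrite mxE lt_max ltxx orbF.
have /dot_pos_eq0 xz := px.
by move=> i; rewrite xz ?mxE// => a; rewrite ltW.
Qed.

Lemma orthogonal_eigenvector_eq0 (x : 'cV[R]_n.+1) :
  S *m x = l *: x -> p *m x = 0 -> x = 0.
Proof.
move=> Sx px; apply/colP => i; rewrite [RHS]mxE; apply/eqP.
rewrite eq_le orthogonal_eigenvector_le0//=.
have := @orthogonal_eigenvector_le0 (- x) _ _ i; rewrite mxE oppr_le0; apply.
  by rewrite mulmxN Sx scalerN.
by rewrite mulmxN px oppr0.
Qed.

Let pinned : 'M[{poly R}]_n.+1 :=
  \matrix_(i, j) if i == 0 then (p 0 j)%:P else char_poly_mx S i j.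

(** The combination of the rows of [X - S] with coefficients [p] is [(X - l) p].
    Substituting it for the first row multiplies the determinant by [p 0 0],
    and then [X - l] comes out of that row. *)
Lemma pinned_det_factor :
  (p 0 0)%:P * char_poly S = ('X - l%:P) * \det pinned.
Proof.
pose P : 'M[{poly R}]_n.+1 :=
  \matrix_(i, j) if i == 0 then (p 0 j)%:P else (i == j)%:R.
pose L : 'rV[{poly R}]_n.+1 := \row_j if j == 0 then 'X - l%:P else 1.
have detP : \det P = (p 0 0)%:P.
  rewrite -det_tr det_trig ?big_ord_recl; last first.
    apply/is_trig_mxP => i j ij; rewrite !mxE.
    have /negPf-> : j != 0 by rewrite -val_eqE/= -lt0n (leq_ltn_trans _ ij).
    by rewrite -val_eqE/= gtn_eqF.
  by rewrite !mxE eqxx big1 ?mulr1// => i _; rewrite !mxE/= eqxx.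
have detL : \det (diag_mx L) = 'X - l%:P.
  rewrite det_diag big_ord_recl mxE eqxx big1 ?mulr1// => i _.
  by rewrite mxE.
rewrite -detP -detL /char_poly -!det_mulmx; congr (\det _).
apply/matrixP => i j; rewrite mul_diag_mx !mxE; case: (eqVneq i 0) => [->|i0].
  under eq_bigr => k _ do rewrite !mxE eqxx mulrBr.
  rewrite big_split/= (bigD1 j)//= eqxx mulr1n big1 ?addr0; last first.
    by move=> k /negPf->; rewrite mulr0n mulr0.
  rewrite mulrBl [(p 0 j)%:P * _]mulrC; congr (_ + _).
  rewrite sumrN; congr (- _).
  under eq_bigr => k _ do rewrite -polyCM.
  rewrite -rmorph_sum/= -polyCM; congr (_%:P).
  by have /matrixP/(_ 0 j) := pS; rewrite !mxE.
rewrite (bigD1 i)//= big1 ?addr0; last first.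
  by move=> k ki; rewrite mxE (negPf i0) eq_sym (negPf ki) mul0r.
by rewrite mxE (negPf i0) eqxx !mxE.
Qed.

(** If [l] were a root of the cofactor [det pinned], a kernel vector [x] of
    [pinned] at [l] would satisfy [p x = 0] and all but the first of the
    equations [S x = l x]; that one follows since [p (S x - l x) = 0]. *)
Lemma perron_root_simple : mup l (char_poly S) = 1%N.
Proof.
have p00 : p 0 0 != 0 by rewrite gt_eqF.
have rootP : ~~ root ((p 0 0)%:P) l by rewrite rootC.
have rootD : ~~ root (\det pinned) l.
  rewrite /root -[_.[l]]/(horner_eval l _) -det_map_mx.
  rewrite -det_tr; apply/det0P => -[v v0 vH].
  pose x := v^T.
  have Hx : map_mx (horner_eval l) pinned *m x = 0.
    by apply: trmx_inj; rewrite trmx_mul trmxK vH trmx0.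
  have px : p *m x = 0.
    apply/matrixP => a b; rewrite !ord1.
    have /matrixP/(_ 0 0) := Hx; rewrite !mxE => Hx0; rewrite -[RHS]Hx0.
    by apply: eq_bigr => j _; rewrite !mxE/= /horner_eval hornerC.
  have Sxi i : i != 0 -> (S *m x - l *: x) i 0 = 0.
    move=> i0; rewrite sub_scale_mxE.
    have /matrixP/(_ i 0) := Hx; rewrite mxE [RHS]mxE => Hxi.
    apply/eqP; rewrite subr_eq0 eq_sym -subr_eq0; apply/eqP.
    rewrite -[RHS]Hxi.
    under [RHS]eq_bigr => j _.
      rewrite !mxE (negPf i0) /horner_eval hornerD hornerN hornerC hornerMn hornerX.
      rewrite mulrDl mulNr mulrnAl.
      over.
    rewrite sumrB [X in _ = X - _](bigD1 i)//= eqxx mulr1n mxE big1 ?addr0; last first.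
      by move=> k ki; rewrite eq_sym (negPf ki) mulr0n.
    by congr (_ - _); rewrite mxE; apply: eq_bigr => j _; rewrite mxE.
  have Sx0 : (S *m x - l *: x) 0 0 = 0.
    have : p *m (S *m x - l *: x) = 0.
      by rewrite mulmxBr mulmxA pS -scalemxAl -scalemxAr subrr.
    move=> /matrixP/(_ 0 0); rewrite mxE (bigD1 0)//= big1 ?addr0; last first.
      by move=> i /Sxi->; rewrite mulr0.
    by rewrite [RHS]mxE => /eqP; rewrite mulf_eq0 (negPf p00) => /eqP.
  have Sx : S *m x = l *: x.
    apply/eqP; rewrite -subr_eq0; apply/eqP/colP => i; rewrite [RHS]mxE.
    by have [->|] := eqVneq i 0; [exact: Sx0 | exact: Sxi].
  have xz := orthogonal_eigenvector_eq0 Sx px.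
  by move: v0; rewrite -[v]trmxK -/x xz trmx0 eqxx.
rewrite -(mupMr _ rootP) pinned_det_factor mupMl//.
by rewrite -[X in mup _ X]expr1 mup_XsubCX eqxx.
Qed.

End PerronVector.

Lemma normC_Re (R : realType) (z : R[i]%C) : `|z| = (complex.Re `|z|)%:C%C.
Proof. by rewrite normc_def. Qed.

Lemma seq_max_norm (R : realType) (rs : seq R[i]%C) : rs != [::] ->
  exists2 z0, z0 \in rs & forall z, z \in rs -> `|z| <= `|z0|.
Proof.
elim: rs => // z rs IH _; have [->|/IH[z0 z0rs z0max]] := eqVneq rs [::].
  by exists z => [|y]; rewrite ?mem_head// inE => /eqP->.
have [zz0|z0z] := real_leP (normr_real z) (normr_real z0).
  exists z0; first by rewrite in_cons z0rs orbT.
  by move=> y; rewrite in_cons => /orP[/eqP->//|/z0max].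
exists z; first exact: mem_head.
move=> y; rewrite in_cons => /orP[/eqP->//|/z0max/le_trans]; apply.
exact: ltW.
Qed.

Lemma max_modulus_eigenvalue (R : realType) (n : nat) (S : 'M[R]_n.+1) :
  exists2 z0, complex_eigenvalue S z0 &
    forall z, complex_eigenvalue S z -> `|z| <= `|z0|.
Proof.
pose cp := char_poly (complexify S).
have [rs rsE] := closed_field_poly_normal cp.
rewrite (monicP (char_poly_monic _)) scale1r in rsE.
have eig z : complex_eigenvalue S z <-> z \in rs.
  by rewrite /complex_eigenvalue eigenvalue_root_char -/cp rsE root_prod_XsubC.
have [|z0 /eig z0S z0max] := @seq_max_norm _ rs.
  apply/negP => /eqP rs0; have := size_char_poly (complexify S).
  by rewrite -/cp rsE rs0 big_nil size_poly1.
by exists z0 => // z /eig; apply: z0max.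
Qed.

Lemma spectral_radius_max (R : realType) (n : nat) (S : 'M[R]_n) z0 :
  complex_eigenvalue S z0 ->
  (forall z, complex_eigenvalue S z -> `|z| <= `|z0|) ->
  spectral_radius S = complex.Re `|z0|.
Proof.
move=> z0S z0max; rewrite /spectral_radius; set E := image _ _.
have ubE : ubound E (complex.Re `|z0|).
  by move=> _ [z /z0max + <-]; rewrite normC_Re [in leRHS]normC_Re lecR.
have E0 : E (complex.Re `|z0|) by exists z0.
apply/eqP; rewrite eq_le; apply/andP; split.
  by apply: ge_sup => //; exists (complex.Re `|z0|).
by apply: ub_le_sup => //; exists (complex.Re `|z0|).
Qed.

(** The positive left eigenvector is the vector of moduli of an eigenvector for
    an eigenvalue of maximal modulus. *)
Theorem perron_frobenius (R : realType) (n : nat) (S : 'M[R]_n.+1) :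
  primitive_mx S ->
  exists l : R, exists2 p : 'rV[R]_n.+1, is_perron_eigenvalue S l &
    (forall j, 0 < p 0 j) /\ p *m S = l *: p.
Proof.
move=> Sprim; have [z0 z0S z0max] := max_modulus_eigenvalue S.
pose l : R := complex.Re `|z0|.
have lE : l%:C%C = `|z0| by rewrite -normC_Re.
have l0 : 0 <= l by rewrite -lecR lE normr_ge0.
have Sl z : complex_eigenvalue S z -> `|z| <= l%:C%C by rewrite lE; apply: z0max.
case: (Sprim) => S0 [k k0 Sk].
have /eigenvalueP[u uS u0] := z0S.
pose w : 'rV[R]_n.+1 := \row_j complex.Re `|u 0 j|.
have wE j : (w 0 j)%:C%C = `|u 0 j| by rewrite mxE -normC_Re.
have w0 j : 0 <= w 0 j by rewrite -lecR wE normr_ge0.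
have wS : w *m S = l *: w.
  apply: subinvariant_eigenvector => // j.
  rewrite -lecR rmorphM/= lE wE -normrM.
  have /matrixP/(_ 0 j) := uS; rewrite [RHS]mxE => <-.
  rewrite !mxE rmorph_sum (le_trans (ler_norm_sum _ _ _))//.
  apply: ler_sum => i _; rewrite mxE normrM rmorphM/= -wE.
  by rewrite [X in _ * X]ger0_norm ?lecR.
have wn0 : w != 0.
  apply: contraNN u0 => /eqP wz; apply/eqP/rowP => j; rewrite [RHS]mxE.
  by apply/eqP; rewrite -normr_eq0 -wE wz mxE.
have wSk : w *m S ^+ k = l ^+ k *: w by exact: left_eigenvector_power.
have lw j : 0 < l ^+ k * w 0 j.
  by have := pos_mulmx_pos Sk w0 wn0 j; rewrite wSk mxE.
have lk0 : 0 < l ^+ k.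
  rewrite lt_def exprn_ge0// andbT; apply/negP => /eqP lk.
  by have := lw 0; rewrite lk mul0r ltxx.
have lpos : 0 < l.
  by rewrite lt_def l0 andbT; apply: contraTneq lk0 => ->; rewrite expr0n gtn_eqF// ltxx.
have wpos j : 0 < w 0 j by rewrite -(pmulr_rgt0 _ lk0).
exists l, w; last by [].
split => //; first by apply/eigenvalueP; exists w.
- exact: (perron_root_simple Sprim lpos wpos wS).
- by rewrite (spectral_radius_max z0S z0max).
Qed.

Lemma perron_eigenvalueE (R : realType) (n : nat) (S : 'M[R]_n) (l : R) :
  is_perron_eigenvalue S l -> perron_eigenvalue S = l.
Proof.
move=> Sl; rewrite /perron_eigenvalue.
by case: xgetP => [_ -> [_ _ _ ->]|/(_ l)]//; case: Sl.
Qed.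
(** * Integer points in linear images of cubes *)
Lemma sum_le_fibers (R : numDomainType) (T U : eqType) (f : T -> U) (w : T -> R)
    (s : seq T) (M : R) :
  (forall u, \sum_(x <- s | f x == u) w x <= M) ->
  \sum_(x <- s) w x <= (size (undup (map f s)))%:R * M.
Proof.
move=> sM.
have -> : \sum_(x <- s) w x =
    \sum_(u <- undup (map f s)) \sum_(x <- s | f x == u) w x.
  under [RHS]eq_bigr => u _ do rewrite big_mkcond.
  rewrite exchange_big/= big_seq [RHS]big_seq; apply: eq_bigr => x xs.
  have fx : f x \in undup (map f s) by rewrite mem_undup map_f.
  rewrite (bigD1_seq (f x)) ?undup_uniq//= eqxx big1 ?addr0// => u.
  by rewrite eq_sym => /negPf->.
rewrite mulr_natl -iter_addr_0 -[X in iter X]count_predT -big_const_seq.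
exact: ler_sum.
Qed.

Lemma size_int_interval (R : realType) (s : seq int) (t r : R) :
  uniq s -> 0 <= r -> (forall z, z \in s -> `|z%:~R - t| <= r) ->
  (size s)%:R <= 2 * r + 2.
Proof.
move=> us r0 sr; pose a := Num.floor (t - r).
pose K := (Num.truncn (2 * r + 1)).+1.
have /uniq_leq_size : uniq s by [].
move=> /(_ [seq a + k%:Z | k <- iota 0 K]).
rewrite size_map size_iota => sK.
apply: (@le_trans _ _ K%:R).
  rewrite ler_nat sK// => z /sr zr.
  have /andP[z1 z2] : t - r <= z%:~R <= t + r.
    by move: zr; rewrite ler_norml lerBlDl lerBrDl => /andP[]; lra.
  have az : a <= z.
    by rewrite -(ler_int R); apply: le_trans z1; exact: floor_le.
  apply/mapP; exists `|z - a|%N; last by rewrite gez0_abs ?subr_ge0// addrCA subrr addr0.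
  rewrite mem_iota/= add0n ltnS /= truncn_ge_nat; last lra.
  rewrite natr_absz ger0_norm ?subr_ge0// intrB.
  have := floorD1_gt (t - r); rewrite -/a intrD; lra.
rewrite /K -natr1; have := @truncn_le _ (2 * r + 1); lra.
Qed.
Lemma sub_mxE (R : zmodType) (m n : nat) (u v : 'M[R]_(m, n)) i j :
  (u - v) i j = u i j - v i j.
Proof. by rewrite !mxE. Qed.

Lemma add_mxE (R : nmodType) (m n : nat) (u v : 'M[R]_(m, n)) i j :
  (u + v) i j = u i j + v i j.
Proof. by rewrite !mxE. Qed.

Section Pivot.
Variables (R : realType) (m : nat) (B : R).

(** One step of Gaussian elimination on the system [N v - b], in the form in
    which both counting arguments use it: [a] is the pivot, [u] the rest of the
    pivot row, [N'] the Schur complement.  Up to constants, smallness of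
    [N v - b] amounts to smallness of its pivot row, which for given
    [dsubmx v] confines the first coordinate to an interval of length of order
    [1 / |a|], and of the reduced system, which involves [dsubmx v] only. *)
Definition pivot_step (N : 'M[R]_(1 + m)) (b : 'cV[R]_(1 + m)) (a : R) (u : 'rV[R]_m)
    (b0 : R) (N' : 'M[R]_m) (b' : 'cV[R]_m) :=
  [/\ 0 < `|a| <= B, forall i j, `|N' i j| <= 2 * B,
      `|\det N| = `|a| * `|\det N'|,
   forall (v : 'cV[R]_(1 + m)) C, (forall i, `|(N *m v - b) i 0| <= C) ->
     `|a * v 0 0 + ((u *m dsubmx v) 0 0 - b0)| <= C /\
     forall i, `|(N' *m dsubmx v - b') i 0| <= 2 * C &
   forall (v : 'cV[R]_(1 + m)) C C', `|a * v 0 0 + ((u *m dsubmx v) 0 0 - b0)| <= C ->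
     0 <= C' -> (forall i, `|(N' *m dsubmx v - b') i 0| <= C') ->
     forall i, `|(N *m v - b) i 0| <= C + C'].

(** As the pivot is the largest entry of its column, the multipliers [c] have
    entries at most 1, so that elimination changes the entries of the matrix
    and of [N v - b] in a controlled way in both directions. *)
Lemma pivot_at_corner (N : 'M[R]_(1 + m)) (b : 'cV[R]_(1 + m)) :
  (forall i j, `|N i j| <= B) -> \det N != 0 ->
  (forall i, `|N i 0| <= `|N 0 0|) ->
  exists a u b0 N' b', pivot_step N b a u b0 N' b'.
Proof.
move=> NB N0 piv; pose a := N 0 0.
have a0 : a != 0.
  apply: contraNneq N0 => aE; rewrite (expand_det_col _ 0) big1// => i _.
  suff -> : N i 0 = 0 by rewrite mul0r.
  by apply/eqP; rewrite -normr_le0 (le_trans (piv i))// -/a aE normr0.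
have a0' : 0 < `|a| by rewrite normr_gt0.
pose c := a^-1 *: dlsubmx N.
have c1 i j : `|c i j| <= 1.
  rewrite !mxE normrM normfV ler_pdivrMl// mulr1.
  rewrite (_ : lshift m j = 0); last by apply: val_inj; rewrite /= ord1.
  exact: piv.
pose u := ursubmx N; pose N' := drsubmx N - c *m u.
pose b' := dsubmx b - c *m usubmx b.
have Na : ulsubmx N = a%:M.
  apply/matrixP => i j; rewrite !mxE !ord1 eqxx mulr1n.
  by congr (N _ _); apply: val_inj.
have mulc (T : 'M[R]_1) i : (c *m T) i 0 = c i 0 * T 0 0.
  by rewrite mxE big_ord1.
have NE : N = block_mx a%:M u (dlsubmx N) (drsubmx N) by rewrite -Na submxK.
have top v : usubmx (N *m v - b) = a *: usubmx v + (u *m dsubmx v - usubmx b).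
  rewrite linearB/= -[v in N *m v]vsubmxK NE mul_block_col col_mxKu.
  by rewrite mul_scalar_mx addrA.
have ca : a *: c = dlsubmx N by rewrite scalerA divff// scale1r.
have bot v : dsubmx (N *m v - b) =
    (N' *m dsubmx v - b') + c *m usubmx (N *m v - b).
  rewrite top linearB/= -[v in N *m v]vsubmxK NE mul_block_col col_mxKd.
  rewrite /N' /b' mulmxBl !mulmxDr mulmxN -scalemxAr scalemxAl ca mulmxA.
  move: (dlsubmx _ *m _) (drsubmx _ *m _) (c *m u *m _) (c *m usubmx b) (dsubmx b).
  by move=> x1 x2 x3 x4 x5; rewrite opprB; apply/matrixP => i j; rewrite !mxE; ring.
have topE v : usubmx (N *m v - b) 0 0 =
    a * v 0 0 + ((u *m dsubmx v) 0 0 - usubmx b 0 0).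
  rewrite top; move: (u *m dsubmx v) => y; rewrite !mxE.
  by congr (a * v _ _ + _); exact: val_inj.
have c_le i (t : R) : `|c i 0 * t| <= `|t| by rewrite normrM ler_piMl.
exists a, u, (usubmx b 0 0), N', b'; split.
- by rewrite a0' NB.
- move=> i j; rewrite !mxE big_ord1 (le_trans (ler_normB _ _))// normrM.
  rewrite mulr_natl mulr2n lerD//.
  rewrite -[leRHS]mul1r ler_pM//.
  by rewrite /u !mxE.
- have : \det (block_mx 1%:M 0 (- c) 1%:M *m N) = a * \det N'.
    rewrite NE mulmx_block !mul1mx !mul0mx !addr0.
    have -> : - c *m a%:M + dlsubmx N = 0.
      by rewrite mul_mx_scalar scalerN ca addNr.
    by rewrite det_ublock det_scalar1 mulNmx addrC.
  rewrite det_mulmx det_lblock !det1 mulr1 mul1r => ->; exact: normrM.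
- move=> v C vC.
  have vu : `|usubmx (N *m v - b) 0 0| <= C by rewrite mxE.
  split=> [|i]; first by rewrite -topE.
  have -> : N' *m dsubmx v - b' = dsubmx (N *m v - b) - c *m usubmx (N *m v - b).
    by rewrite bot addrK.
  rewrite sub_mxE mulc (le_trans (ler_normB _ _))//.
  rewrite mulr_natl mulr2n lerD//; first by rewrite mxE.
  exact: le_trans (c_le _ _) vu.
- move=> v C C' vC C'0 vC' i; rewrite -topE in vC.
  have -> : (N *m v - b) i 0 =
      col_mx (usubmx (N *m v - b)) (dsubmx (N *m v - b)) i 0 by rewrite vsubmxK.
  case: (split_ordP i) => j ->.
    by rewrite col_mxEu ord1 ler_wpDr.
  rewrite col_mxEd bot add_mxE mulc (le_trans (ler_normD _ _))//.
  by rewrite addrC lerD// (le_trans (c_le _ _)).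
Qed.
End Pivot.

Lemma pivot_exists (R : realType) (m : nat) (B : R) (N : 'M[R]_(1 + m))
    (b : 'cV[R]_(1 + m)) :
  (forall i j, `|N i j| <= B) -> \det N != 0 ->
  exists a u b0 N' b', pivot_step B N b a u b0 N' b'.
Proof.
move=> NB N0; pose i0 := [arg max_(i > 0%R) `|N i 0|]%O.
have i0max i : `|N i 0| <= `|N i0 0|.
  by rewrite /i0; case: arg_maxP => // k _ /(_ i isT).
pose N1 := xrow i0 0 N; pose b1 := xrow i0 0 b.
have detN1 : `|\det N1| = `|\det N|.
  by rewrite /N1 xrowE det_mulmx det_perm normrM normrX normrN1 expr1n mul1r.
have entry v i : (N1 *m v - b1) i 0 = (N *m v - b) (tperm i0 0 i) 0.
  have -> : N1 *m v - b1 = xrow i0 0 (N *m v - b).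
    by rewrite /N1 /b1 !xrowE mulmxBr mulmxA.
  by rewrite mxE.
have [||i|a [u [b0 [N' [b' [aB N'B detE fwd bwd]]]]]] :=
    @pivot_at_corner _ _ B N1 b1.
- by move=> i j; rewrite mxE.
- by rewrite -normr_eq0 detN1 normr_eq0.
- by rewrite !mxE tpermR.
exists a, u, b0, N', b'; split => //.
- by rewrite -detN1.
- by move=> v C vC; apply: fwd => i; rewrite entry.
- move=> v C C' vC C'0 vC' i.
  by have := bwd v C C' vC C'0 vC' (tperm i0 0 i); rewrite entry tpermK.
Qed.

Definition real_of_int_col (R : realType) (d : nat) (z : 'cV[int]_d) : 'cV[R]_d :=
  map_mx intr z.

(** The bound does not depend on [N] itself, only on a bound of its entries: each
    elimination step leaves, above a given integer vector in one dimension
    less, at most [2 C / |a| + 2 <= (2 C + 2 B) / |a|] integers, and the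
    product of the [|a|] is [|det N|]. *)
Lemma lattice_count_upper (R : realType) (d : nat) (B C : R) : 0 <= C ->
  exists K : R, forall (N : 'M[R]_d) (b : 'cV[R]_d) (s : seq 'cV[int]_d),
    (forall i j, `|N i j| <= B) -> \det N != 0 -> uniq s ->
    (forall z, z \in s -> forall i, `|(N *m real_of_int_col R z - b) i 0| <= C) ->
    (size s)%:R * `|\det N| <= K.
Proof.
elim: d B C => [|m IH] B C C0.
  exists 1 => N b s _ _ us _; rewrite det_mx00 normr1 mulr1 -[1]/(1%:R) ler_nat.
  rewrite (@uniq_leq_size _ _ [:: 0])// => z _.
  by rewrite inE; apply/eqP/matrixP; case.
have [|K HK] := IH (2 * B) (2 * C); first by rewrite mulr_ge0.
exists (K * (2 * C + 2 * B)) => N b s NB N0 us sC.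
have [a [u [b0 [N' [b' [/andP[a0 aB] N'B detE fwd _]]]]]] := @pivot_exists R m B N b NB N0.
have N'0 : \det N' != 0.
  by apply: contraNneq N0 => N'z; rewrite -normr_eq0 detE N'z normr0 mulr0.
pose f (z : 'cV[int]_(1 + m)) := dsubmx z.
have fE z : dsubmx (real_of_int_col R z) = real_of_int_col R (f z).
  by rewrite /real_of_int_col map_dsubmx.
have tK : (size (undup (map f s)))%:R * `|\det N'| <= K.
  apply: (HK N' b') => //; first exact: undup_uniq.
  move=> z'; rewrite mem_undup => /mapP[z zs ->] i.
  by rewrite -fE; have [_] := fwd _ _ (sC _ zs); apply.
have fib y : \sum_(z <- s | f z == y) 1 <= 2 * (C / `|a|) + 2.
  rewrite -big_filter big_const_seq count_predT iter_addr_0.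
  rewrite -(size_map (fun z : 'cV[int]_(1 + m) => z 0 0)).
  apply: (@size_int_interval _ _
    (- ((u *m real_of_int_col R y) 0 0 - b0) / a)).
  - rewrite map_inj_in_uniq ?filter_uniq// => z1 z2.
    rewrite !mem_filter => /andP[/eqP f1 _] /andP[/eqP f2 _] z12.
    rewrite -[z1]vsubmxK -[z2]vsubmxK -/(f z1) -/(f z2) f1 f2; congr col_mx.
    apply/matrixP => i j; rewrite !mxE !ord1.
    rewrite (_ : lshift m 0 = 0)//; exact: val_inj.
  - by rewrite divr_ge0.
  move=> _ /mapP[z + ->]; rewrite mem_filter => /andP[/eqP fz zs].
  have [+ _] := fwd _ _ (sC _ zs); rewrite fE fz mxE => zC.
  rewrite ler_pdivlMr// -normrM mulrBl divfK -?normr_gt0// opprK.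
  by rewrite mulrC.
have := sum_le_fibers fib; rewrite big_const_seq count_predT iter_addr_0 => sz.
rewrite detE.
apply: le_trans (_ : (size (undup (map f s)))%:R * (2 * (C / `|a|) + 2) *
   (`|a| * `|\det N'|) <= _).
  by rewrite ler_wpM2r// mulr_ge0.
have -> : forall x y : R, x * (2 * (C / `|a|) + 2) * (`|a| * y) = x * y * (2 * C + 2 * `|a|).
  by move=> x y; field; rewrite gt_eqF.
have B0 : 0 < B by apply: lt_le_trans aB.
apply: ler_pM => //; rewrite ?mulr_ge0 ?addr_ge0 ?mulr_ge0//.
by rewrite lerD2l ler_wpM2l.
Qed.

(** Above each integer vector found in one dimension less, the interval around
    [t] of radius [B / |a| >= 1] contains at least [B / |a|] integers. *)
Lemma lattice_count_lower (R : realType) (d : nat) (B : R) : 0 < B ->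
  exists C c : R, [/\ 0 <= C, 0 < c &
  forall (N : 'M[R]_d) (b : 'cV[R]_d),
    (forall i j, `|N i j| <= B) -> \det N != 0 ->
    exists s : seq 'cV[int]_d, [/\ uniq s,
      forall z, z \in s -> forall i, `|(N *m real_of_int_col R z - b) i 0| <= C &
      c <= (size s)%:R * `|\det N|]].
Proof.
elim: d B => [|m IH] B B0.
  exists 0, 1; split => // N b _ _; exists [:: 0]; split => //.
    by move=> z _; case.
  by rewrite det_mx00 normr1 mulr1.
have [|C [c [C0 c0 HC]]] := IH (2 * B); first by rewrite mulr_gt0.
exists (B + C), (c * B); split; rewrite ?addr_ge0 ?mulr_gt0 ?(ltW B0)// => N b NB N0.
have [a [u [b0 [N' [b' [/andP[a0 aB] N'B detE _ bwd]]]]]] := @pivot_exists R m B N b NB N0.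
have N'0 : \det N' != 0.
  by apply: contraNneq N0 => N'z; rewrite -normr_eq0 detE N'z normr0 mulr0.
have [s' [us' s'C s'c]] := HC N' b' N'B N'0.
pose t (z' : 'cV[int]_m) : R := - ((u *m real_of_int_col R z') 0 0 - b0) / a.
pose M := (Num.truncn (B / `|a|)).+1.
pose g (z' : 'cV[int]_m) (k : nat) : 'cV[int]_(1 + m) :=
  col_mx (const_mx (Num.floor (t z') + k%:Z)) z'.
have M0 : B / `|a| <= M%:R by rewrite ltW// truncnS_gt.
exists [seq g z' k | z' <- s', k <- iota 0 M]; split.
- apply: allpairs_uniq => //; first exact: iota_uniq.
  move=> [z1 k1] [z2 k2] _ _ /= e.
  have z12 : z1 = z2.
    have : dsubmx (g z1 k1) = dsubmx (g z2 k2) by rewrite e.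
    by rewrite /g !col_mxKd.
  have /matrixP/(_ 0 0) : usubmx (g z1 k1) = usubmx (g z2 k2) by rewrite e.
  rewrite /g !col_mxKu.
  by rewrite !mxE z12 => /addrI[->].
- move=> _ /allpairsP[[z' k] [z's + ->]].
  rewrite mem_iota leq0n add0n ltnS => kM; rewrite /= in z's kM *.
  have dg : dsubmx (real_of_int_col R (g z' k)) = real_of_int_col R z'.
    by rewrite /real_of_int_col -map_dsubmx col_mxKd.
  apply: bwd => //; last by rewrite dg; apply: s'C.
  have -> : real_of_int_col R (g z' k) 0 0 = (Num.floor (t z'))%:~R + k%:R.
    by rewrite mxE /g mxE; case: splitP => // j _; rewrite mxE intrD.
  rewrite dg.
  have -> : (u *m real_of_int_col R z') 0 0 - b0 = a * - t z'.
    by rewrite /t mulNr opprK mulrC divfK// -normr_gt0.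
  rewrite -mulrDr normrM -ler_pdivlMl// mulrC.
  have ba1 : 1 <= B / `|a| by rewrite ler_pdivlMr// mul1r.
  have kB : k%:R <= B / `|a|.
    by rewrite -truncn_ge_nat// divr_ge0// ltW.
  have /andP[f1 f2] := floor_itv (t z').
  have k0 : 0 <= k%:R :> R by [].
  rewrite intrD mulr1z in f2; rewrite ler_norml.
  by apply/andP; split; move: ba1 kB; move: (B / _) => q; lra.
- rewrite size_allpairs size_iota detE natrM.
  apply: le_trans (_ : (size s')%:R * `|\det N'| * B <= _).
    by rewrite ler_wpM2r// ltW.
  have -> : (size s')%:R * M%:R * (`|a| * `|\det N'|) =
    (size s')%:R * `|\det N'| * (M%:R * `|a|) by ring.
  by rewrite ler_wpM2l ?mulr_ge0// -ler_pdivrMr.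
Qed.
(** * Counting points of discrete and of relatively dense multisets *)

(** Bounds for the number of points of [X] in [F] with multiplicity, expressed
    through finite sets, so that no cardinality of [F] has to be defined. *)
Definition count_le (R : realType) (d : nat) (X : multiset R d)
    (F : 'cV[R]_d -> Prop) (a : R) : Prop :=
  forall s : seq 'cV[R]_d, uniq s -> (forall x, x \in s -> F x) ->
    \sum_(x <- s) (X x)%:R <= a.

Definition count_ge (R : realType) (d : nat) (X : multiset R d)
    (F : 'cV[R]_d -> Prop) (a : R) : Prop :=
  exists s : seq 'cV[R]_d, [/\ uniq s, forall x, x \in s -> F x &
    a <= \sum_(x <- s) (X x)%:R].

Lemma count_ge_le (R : realType) (d : nat) (X : multiset R d) F (a b : R) :
  count_ge X F a -> count_le X F b -> a <= b.
Proof. by move=> [s [us sF as_]] bF; apply: le_trans as_ (bF _ us sF). Qed.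

Lemma count_le_sub (R : realType) (d : nat) (X : multiset R d)
    (F G : 'cV[R]_d -> Prop) (a : R) :
  (forall x, G x -> F x) -> count_le X F a -> count_le X G a.
Proof. by move=> GF Fa s us sG; apply: Fa => // x /sG/GF. Qed.

Lemma count_ge_sub (R : realType) (d : nat) (X : multiset R d)
    (F G : 'cV[R]_d -> Prop) (a : R) :
  (forall x, G x -> F x) -> count_ge X G a -> count_ge X F a.
Proof. by move=> GF [s [us sG as_]]; exists s; split => // x /sG/GF. Qed.

Lemma mulmx_entry_le (R : realType) (m : nat) (N : 'M[R]_m) (v : 'cV[R]_m) (B r : R) :
  (forall i j, `|N i j| <= B) -> (forall j, `|v j 0| <= r) ->
  forall i, `|(N *m v) i 0| <= m%:R * (B * r).
Proof.
move=> NB vr i; rewrite mxE (le_trans (ler_norm_sum _ _ _))//.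
rewrite mulr_natl -[m in _ *+ m]card_ord -sumr_const ler_sum// => j _.
by rewrite normrM ler_pM.
Qed.

Lemma enorm_lt (R : realType) (d : nat) (v : 'cV[R]_d) (r : R) :
  0 < r -> (forall i, `|v i 0| <= r / d.+1%:R) -> enorm v < r.
Proof.
move=> r0 vr; have q0 : 0 <= r / d.+1%:R by rewrite divr_ge0// ltW.
have -> : r = Num.sqrt (r ^+ 2) by rewrite sqrtr_sqr gtr0_norm.
rewrite ltr_sqrt ?exprn_gt0//.
apply: (@le_lt_trans _ _ (d%:R * (r / d.+1%:R) ^+ 2)).
  rewrite mulr_natl -[d in _ *+ d]card_ord -sumr_const ler_sum// => i _.
  by rewrite -real_normK ?num_real// lerXn2r ?nnegrE.
rewrite exprMn mulrCA gtr_pMr ?exprn_gt0// exprVn ltr_pdivrMr ?exprn_gt0//.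
rewrite mul1r -natrX ltr_nat; apply: leq_trans (ltnSn d) _.
by rewrite -[X in (X <= _)%N]expn1 leq_pexp2l.
Qed.

Lemma entry_le_enorm (R : realType) (d : nat) (v : 'cV[R]_d) (r : R) :
  enorm v <= r -> forall i, `|v i 0| <= r.
Proof.
move=> vr i; apply: le_trans vr; rewrite -sqrtr_sqr ler_wsqrtr//.
by rewrite (bigD1 i)//= lerDl sumr_ge0// => j _; rewrite sqr_ge0.
Qed.

Lemma discrete_ball_count (R : realType) (d : nat) (X : multiset R d) (c : 'cV[R]_d)
    (r M : R) :
  (\esum_(x in [set x | (enorm (x - c) < r)%R]%classic) ((X x)%:R)%:E <= M%:E)%E ->
  count_le X (fun x => enorm (x - c) < r) M.
Proof.
move=> XM s us sr; rewrite -lee_fin -sumEFin; apply: le_trans XM.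
rewrite fsbig_seq//; apply: ereal_sup_ubound.
by exists [set` s]%classic => //; split; [exact: finite_seq | move=> x /sr].
Qed.

(** Cells of a cubic grid of mesh [h] lie in balls of radius [r], and the grid
    points of cells that meet the region lie in a slightly larger region. *)
Lemma discrete_count_upper (R : realType) (d : nat) (X : multiset R d) (B rho : R) :
  0 <= B -> weakly_uniformly_discrete X ->
  exists c : R, forall N : 'M[R]_d, (forall i j, `|N i j| <= B) -> \det N != 0 ->
    count_le X (fun x => forall i, `|(N *m x) i 0| <= rho) (c / `|\det N|).
Proof.
move=> B0 [r r0 [m _ Xm]]; pose h := r / d.+1%:R.
have h0 : 0 < h by rewrite divr_gt0.
have [|K HK] := @lattice_count_upper R d B (`|rho| / h + d%:R * (B * 1)).
  by rewrite mulr1 addr_ge0 ?divr_ge0 ?mulr_ge0// ltW.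
exists (K * m%:R) => N NB N0 s us sF.
pose f (x : 'cV[R]_d) : 'cV[int]_d := \col_i Num.floor (x i 0 / h).
have fx x i : `|(h^-1 *: x - real_of_int_col R (f x)) i 0| <= 1.
  rewrite sub_mxE !mxE [h^-1 * _]mulrC.
  have /andP[f1 f2] := floor_itv (x i 0 / h).
  rewrite intrD mulr1z in f2; rewrite ler_norml; lra.
have fib z : \sum_(x <- s | f x == z) (X x)%:R <= m%:R :> R.
  rewrite -big_filter.
  apply: (discrete_ball_count (Xm (h *: real_of_int_col R z))).
    by rewrite filter_uniq.
  move=> x; rewrite mem_filter => /andP[/eqP <- _]; apply: enorm_lt => // i.
  have -> : x - h *: real_of_int_col R (f x) = h *: (h^-1 *: x - real_of_int_col R (f x)).
    by rewrite scalerBr scalerA divff ?gt_eqF// scale1r.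
  by rewrite mxE normrM gtr0_norm// -[leRHS]mulr1 ler_pM2l.
apply: le_trans (sum_le_fibers fib) _.
rewrite mulrAC ler_wpM2r// ler_pdivlMr ?normr_gt0//.
apply: (HK N 0) => //; first exact: undup_uniq.
move=> z; rewrite mem_undup => /mapP[x xs ->] i; rewrite subr0.
have -> : real_of_int_col R (f x) =
    h^-1 *: x - (h^-1 *: x - real_of_int_col R (f x)) by rewrite opprB addrC subrK.
rewrite mulmxBr sub_mxE (le_trans (ler_normB _ _))// lerD//; last exact: mulmx_entry_le.
rewrite -scalemxAr mxE normrM gtr0_norm ?invr_gt0// mulrC ler_wpM2r ?invr_ge0 ?(ltW h0)//.
exact: le_trans (sF _ xs i) (ler_norm _).
Qed.

Lemma int_close_le (R : realType) (h r y : R) (a b : int) : 0 < h -> 2 * r < h ->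
  `|y - h * a%:~R| <= r -> `|y - h * b%:~R| <= r -> a <= b.
Proof.
move=> h0 rh; rewrite !ler_norml => /andP[a1 a2] /andP[b1 b2].
rewrite leNgt; apply/negP; rewrite -lezD1 -(ler_int R) intrD mulr1z => ba.
have : h * (b%:~R + 1) <= h * a%:~R by rewrite ler_pM2l.
rewrite mulrDr mulr1; lra.
Qed.

(** Around each grid point there is a point of [X]; the mesh [2 r + 1] makes these
    points distinct. *)
Lemma dense_count_lower (R : realType) (d : nat) (X : multiset R d) (B : R) :
  0 < B -> relatively_dense X ->
  exists rho c : R, [/\ 0 <= rho, 0 < c &
  forall N : 'M[R]_d, (forall i j, `|N i j| <= B) -> \det N != 0 ->
    count_ge X (fun x => forall i, `|(N *m x) i 0| <= rho) (c / `|\det N|)].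
Proof.
move=> B0 [r r0 Xr]; pose h := 2 * r + 1.
have h0 : 0 < h by rewrite /h; lra.
have [C [c [C0 c0 HC]]] := @lattice_count_lower R d B B0.
have /choice[pt ptP] : forall z : 'cV[int]_d, exists x, (0 < X x)%N /\
    enorm (x - h *: real_of_int_col R z) <= r.
  by move=> z; have [x] := Xr (h *: real_of_int_col R z); exists x.
have ptX z : (0 < X (pt z))%N by case: (ptP z).
have pte z i : `|(pt z - h *: real_of_int_col R z) i 0| <= r.
  by case: (ptP z) => _ /entry_le_enorm.
exists (h * C + d%:R * (B * r)), c; split => //.
  by rewrite addr_ge0// ?mulr_ge0// ltW.
move=> N NB N0; have [s [us sC sc]] := HC N 0 NB N0.
exists (map pt s); split.
- rewrite map_inj_uniq// => z1 z2 e12; apply/colP => i.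
  have := pte z1 i; have := pte z2 i; rewrite e12 !sub_scale_mxE !mxE => r2 r1.
  by apply/eqP; rewrite eq_le; apply/andP; split;
    [apply: (int_close_le h0 _ r1 r2) | apply: (int_close_le h0 _ r2 r1)];
    rewrite /h; lra.
- move=> _ /mapP[z zs ->] i.
  have -> : pt z = h *: real_of_int_col R z + (pt z - h *: real_of_int_col R z).
    by rewrite addrC subrK.
  rewrite mulmxDr add_mxE (le_trans (ler_normD _ _))// lerD//; last exact: mulmx_entry_le.
  rewrite -scalemxAr mxE normrM gtr0_norm// ler_pM2l//.
  by have := sC _ zs i; rewrite subr0.
- rewrite ler_pdivrMr ?normr_gt0// (le_trans sc)// ler_wpM2r//.
  rewrite big_map -[X in X <= _]mulr1 mulr_natl -iter_addr_0 -[X in iter X]count_predT.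
  by rewrite -big_const_seq ler_sum// => z _; rewrite ler1n.
Qed.
(** * Iterating the inflation equation *)
Lemma expanding_unitmx (R : realType) (d : nat) (A : 'M[R]_d) :
  expanding A -> A \in unitmx.
Proof.
move=> Aexp; rewrite unitmxE unitfE; apply/negP => /eqP A0.
have : \det (complexify A) == 0 by rewrite det_map_mx A0 rmorph0.
move=> /det0P[v v0 vA].
have /Aexp : complex_eigenvalue A 0.
  by apply/eigenvalueP; exists v => //; rewrite vA scale0r.
by rewrite normr0 ltr10.
Qed.

Lemma expanding_inverse_contracting (R : realType) (d : nat) (A : 'M[R]_d) z :
  expanding A -> complex_eigenvalue (invmx A) z -> `|z| < 1.
Proof.
move=> Aexp /eigenvalueP[v]; rewrite /complexify map_invmx => vA v0.
have Au : complexify A \in unitmx by rewrite map_unitmx expanding_unitmx.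
have vE : v = z *: (v *m complexify A).
  by rewrite scalemxAl -vA -mulmxA mulVmx// mulmx1.
have z0 : z != 0 by apply: contraNneq v0 => zz; rewrite vE zz scale0r.
have : complex_eigenvalue A z^-1.
  by apply/eigenvalueP; exists v => //; rewrite [in RHS]vE scalerA mulVf// scale1r.
by move=> /Aexp; rewrite normfV invf_gt1// normr_gt0.
Qed.

Lemma growth_rate_le (R : realType) (a b x y : R) : 0 < a -> 0 < x -> 0 < y ->
  (forall k, a * x ^+ k <= b * y ^+ k) -> x <= y.
Proof.
move=> a0 x0 y0 ab; pose h := x / y - 1.
have bern k : 1 + k%:R * h <= (x / y) ^+ k.
  elim: k => [|k IH]; first by rewrite mul0r addr0 expr0.
  have q0 : 0 <= x / y by rewrite divr_ge0// ltW.
  rewrite exprS; apply: le_trans (ler_wpM2l q0 IH).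
  have -> : x / y = 1 + h by rewrite /h addrC subrK.
  rewrite -natr1 -subr_ge0.
  have -> : (1 + h) * (1 + k%:R * h) - (1 + (k%:R + 1) * h) = k%:R * h ^+ 2 by ring.
  by rewrite mulr_ge0// sqr_ge0.
suff : h <= 0 by rewrite subr_le0 ler_pdivrMr// mul1r.
apply: (@bounded_multiples_le0 _ _ (b / a)) => k.
apply: (@le_trans _ _ ((x / y) ^+ k)); first by have := bern k; lra.
rewrite ler_pdivlMr// mulrC expr_div_n mulrA ler_pdivrMr ?exprn_gt0//.
Qed.

Lemma ler_sum_subset (R : numDomainType) (T : eqType) (w : T -> R) (s1 s2 : seq T) :
  (forall x, 0 <= w x) -> uniq s1 -> uniq s2 -> {subset s1 <= s2} ->
  \sum_(x <- s1) w x <= \sum_(x <- s2) w x.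
Proof.
move=> w0 u1 u2 s12.
have s1E : perm_eq s1 [seq x <- s2 | x \in s1].
  apply: uniq_perm; rewrite ?filter_uniq// => x.
  by rewrite mem_filter andb_idr// => /s12.
rewrite (perm_big _ s1E) big_filter big_mkcond; apply: ler_sum => x _.
by case: ifP.
Qed.

Lemma orbit_vector_sums_bounded (R : realType) (m : nat) (M : 'M[R]_m.+1)
    (vs : seq 'cV[R]_m.+1) :
  (forall z, complex_eigenvalue M z -> `|z| < 1) ->
  exists E : R, forall K,
    \sum_(k < K) \sum_(v <- vs) \sum_i `|(M ^+ k *m v) i 0| <= E.
Proof.
move=> M1.
have /choice[B HB] := fun ij : 'I_m.+1 * 'I_m.+1 =>
  real_contracting_power_sums_bounded M1 ij.1 ij.2.
exists (\sum_(v <- vs) \sum_i \sum_j B (i, j) * `|v j 0|) => K.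
rewrite exchange_big ler_sum//= => v _.
rewrite exchange_big ler_sum//= => i _.
apply: (@le_trans _ _ (\sum_(k < K) \sum_j `|(M ^+ k) i j| * `|v j 0|)).
  apply: ler_sum => k _; rewrite mxE (le_trans (ler_norm_sum _ _ _))//.
  by apply: ler_sum => j _; rewrite normrM.
rewrite exchange_big ler_sum//= => j _.
by rewrite -mulr_suml ler_wpM2r//; apply: (HB (i, j)).
Qed.

Lemma bounded_powers (R : realType) (m : nat) (M : 'M[R]_m.+1) :
  (forall z, complex_eigenvalue M z -> `|z| < 1) ->
  exists2 B : R, 0 < B & forall k i j, `|(M ^+ k) i j| <= B.
Proof.
move=> M1.
have /choice[B HB] := fun ij : 'I_m.+1 * 'I_m.+1 =>
  real_contracting_power_sums_bounded M1 ij.1 ij.2.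
have le_B k ij : `|(M ^+ k) ij.1 ij.2| <= B ij.
  apply: le_trans (HB ij k.+1); rewrite big_ord_recr lerDr.
  by rewrite sumr_ge0.
have B0 ij : 0 <= B ij by apply: le_trans (le_B 0%N ij).
exists (1 + \sum_ij B ij); first by rewrite ltr_pwDl// sumr_ge0.
move=> k i j; apply: le_trans (le_B k (i, j)) _.
by rewrite (bigD1 (i, j))//= addrCA lerDl addr_ge0// sumr_ge0.
Qed.

Section Inflation.
Variables (R : realType) (d n : nat) (A : 'M[R]_d.+1).
Variables (D : 'I_n.+1 -> 'I_n.+1 -> {fset 'cV[R]_d.+1}).
Variable X : 'I_n.+1 -> multiset R d.+1.
Hypothesis A_unit : A \in unitmx.
Hypothesis X_fix : inflation A D X = X.

Local Notation M := (invmx A).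
Local Notation S := (subdivision_mx D).

(** The image under [A^k] of the cube of half-side [rho] (empty if [rho < 0]). *)
Definition image_box (k : nat) (rho : R) (x : 'cV[R]_d.+1) : Prop :=
  forall i, `|(M ^+ k *m x) i 0| <= rho.

Definition digits : seq 'cV[R]_d.+1 :=
  flatten [seq enum_fset (D ij.1 ij.2) | ij <- enum {: 'I_n.+1 * 'I_n.+1}].

Definition digit_spread (k : nat) : R :=
  \sum_(v <- digits) \sum_i `|(M ^+ k *m v) i 0|.

Lemma digit_spread_le k i j v : v \in D i j ->
  forall a, `|(M ^+ k *m v) a 0| <= digit_spread k.
Proof.
move=> vD a; have vd : v \in digits.
  by apply/flatten_mapP; exists (i, j); rewrite ?mem_enum.
rewrite /digit_spread (big_rem v)//= (bigD1 a)//= -addrA lerDl.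
by rewrite addr_ge0// !sumr_ge0// => w _; rewrite sumr_ge0.
Qed.

Lemma multiplicity_inflation i x : ((X i x)%:R : R) =
  \sum_j \sum_(v <- D i j) (X j (M *m (x - v)))%:R.
Proof.
rewrite -[in LHS]X_fix /inflation natr_sum; apply: eq_bigr => j _.
by rewrite /mset_add natr_sum.
Qed.

Lemma backward_inj v : injective (fun x : 'cV[R]_d.+1 => M *m (x - v)).
Proof.
move=> x y /(congr1 (mulmx A)); rewrite !mulmxA mulmxV// !mul1mx.
exact: addIr.
Qed.

Lemma sum_subdivision i (a : 'cV[R]_n.+1) :
  (S *m a) i 0 = \sum_j \sum_(v <- D i j) a j 0.
Proof.
rewrite mxE; apply: eq_bigr => j _.
by rewrite mxE big_const_seq count_predT iter_addr_0 mulr_natl.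
Qed.

(** The maps [x -> M (x - v)] send the points counted on the left injectively to
    points of the [X_j], and [image_box k.+1 rho] into a box of level [k] that
    is enlarged by the contribution of [v]. *)
Lemma count_le_step k rho (a : 'cV[R]_n.+1) i :
  (forall j, count_le (X j) (image_box k (rho + digit_spread k.+1)) (a j 0)) ->
  count_le (X i) (image_box k.+1 rho) ((S *m a) i 0).
Proof.
move=> Xa s us sF; rewrite sum_subdivision.
under eq_bigr => x _ do rewrite multiplicity_inflation.
rewrite exchange_big ler_sum//= => j _.
rewrite exchange_big/= big_seq [leRHS]big_seq ler_sum//= => v vD.
rewrite -(big_map (fun x => M *m (x - v)) xpredT (fun y => (X j y)%:R : R)).
apply: Xa; first by rewrite map_inj_uniq//; exact: backward_inj.
move=> _ /mapP[x xs ->] b.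
rewrite mulmxA -[M ^+ k *m M]exprSr mulmxBr sub_mxE (le_trans (ler_normB _ _))//.
by rewrite lerD// ?sF// (digit_spread_le _ vD).
Qed.

(** The images [A y + v] of points [y] of the [X_j]; by the shrinking of the box
    of level [k] they remain in [image_box k.+1 rho].  Images of different
    pairs may coincide, and then the multiplicities add up. *)
Lemma count_ge_step k rho (a : 'cV[R]_n.+1) i :
  (forall j, count_ge (X j) (image_box k (rho - digit_spread k.+1)) (a j 0)) ->
  count_ge (X i) (image_box k.+1 rho) ((S *m a) i 0).
Proof.
move=> /choice[s_ Xa].
pose s := undup (flatten [seq [seq A *m y + v | v <- enum_fset (D i j), y <- s_ j]
  | j <- enum 'I_n.+1]).
have us : uniq s by exact: undup_uniq.
have sP j v y : v \in D i j -> y \in s_ j -> A *m y + v \in s.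
  move=> vD ys; rewrite mem_undup; apply/flatten_mapP; exists j; rewrite ?mem_enum//.
  by apply/allpairsP; exists (v, y).
exists s; split => //.
- move=> x; rewrite mem_undup => /flatten_mapP[j _ /allpairsP[[v y] [/= vD ys ->]]] b.
  rewrite mulmxDr mulmxA {1}exprSr -[M ^+ k * M]/(M ^+ k *m M) mulmxKV//.
  rewrite add_mxE (le_trans (ler_normD _ _))//.
  rewrite -[leRHS](subrK (digit_spread k.+1)).
  by rewrite lerD// ?(digit_spread_le _ vD)//; case: (Xa j) => _ + _; apply.
rewrite sum_subdivision.
under [leRHS]eq_bigr => x _ do rewrite multiplicity_inflation.
rewrite [leRHS]exchange_big ler_sum//= => j _.
rewrite [leRHS]exchange_big/= big_seq [leRHS]big_seq ler_sum//= => v vD.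
rewrite -(big_map (fun x => M *m (x - v)) xpredT (fun y => (X j y)%:R : R)).
case: (Xa j) => uj _ aj; apply: le_trans aj _; apply: ler_sum_subset => //.
  by rewrite map_inj_uniq//; exact: backward_inj.
move=> y ys; apply/mapP; exists (A *m y + v); first exact: sP vD ys.
by rewrite addrK mulKmx.
Qed.

Lemma subdivision_powerS k (a : 'cV[R]_n.+1) : S ^+ k.+1 *m a = S *m (S ^+ k *m a).
Proof. by rewrite exprS mulmxA. Qed.

Lemma count_le_iter k rho (a : 'cV[R]_n.+1) :
  (forall j, count_le (X j)
     (image_box 0 (rho + \sum_(l < k) digit_spread l.+1)) (a j 0)) ->
  forall i, count_le (X i) (image_box k rho) ((S ^+ k *m a) i 0).
Proof.
elim: k rho => [|k IH] rho Xa i.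
  by rewrite expr0 mul1mx; have := Xa i; rewrite big_ord0 addr0.
rewrite subdivision_powerS; apply: count_le_step => j; apply: IH => l.
by have := Xa l; rewrite big_ord_recr/= [X in rho + X]addrC addrA.
Qed.

Lemma count_ge_iter k rho (a : 'cV[R]_n.+1) :
  (forall j, count_ge (X j)
     (image_box 0 (rho - \sum_(l < k) digit_spread l.+1)) (a j 0)) ->
  forall i, count_ge (X i) (image_box k rho) ((S ^+ k *m a) i 0).
Proof.
elim: k rho => [|k IH] rho Xa i.
  by rewrite expr0 mul1mx; have := Xa i; rewrite big_ord0 subr0.
rewrite subdivision_powerS; apply: count_ge_step => j; apply: IH => l.
by have := Xa l; rewrite big_ord_recr/= [X in rho - X]addrC opprD addrA.
Qed.

End Inflation.

(** * Comparing the growth rates *)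
Lemma perron_weighted_power (R : realType) (n : nat) (S : 'M[R]_n.+1) (l : R)
    (p : 'rV[R]_n.+1) (k : nat) (a : 'cV[R]_n.+1) :
  p *m S = l *: p -> \sum_i p 0 i * (S ^+ k *m a) i 0 = l ^+ k * \sum_i p 0 i * a i 0.
Proof.
move=> pS; have pSk : p *m S ^+ k = l ^+ k *: p by exact: left_eigenvector_power.
have -> : \sum_i p 0 i * (S ^+ k *m a) i 0 = (p *m (S ^+ k *m a)) 0 0 by rewrite [RHS]mxE.
by rewrite mulmxA pSk -scalemxAl mxE; congr (_ * _); rewrite mxE.
Qed.

Lemma det_power (R : comNzRingType) (m : nat) (N : 'M[R]_m.+1) k :
  \det (N ^+ k) = \det N ^+ k.
Proof. by elim: k => [|k IH]; rewrite ?expr0 ?det1// !exprS det_mulmx IH. Qed.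

Lemma growth_of_inflation (R : realType) (d n : nat) (A : 'M[R]_d.+1)
    (D : 'I_n.+1 -> 'I_n.+1 -> {fset 'cV[R]_d.+1}) (X : 'I_n.+1 -> multiset R d.+1)
    (l : R) (p : 'rV[R]_n.+1) :
  expanding A -> weak_Delone_family A D X ->
  0 < l -> (forall j, 0 < p 0 j) -> p *m subdivision_mx D = l *: p ->
  l = `|\det A|.
Proof.
move=> Aexp [Xfix XD] l0 p0 pS.
have Au := expanding_unitmx Aexp.
have M1 z := @expanding_inverse_contracting R d.+1 A z Aexp.
have [B B0 MB] := bounded_powers M1.
set delta := `|\det A|.
have delta0 : 0 < delta by rewrite normr_gt0 -unitfE -unitmxE.
have detM k : `|\det (invmx A ^+ k)| = (delta ^+ k)^-1.
  by rewrite det_power det_inv normrX normfV exprVn.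
have detM0 k : \det (invmx A ^+ k) != 0.
  by rewrite -normr_gt0 detM invr_gt0 exprn_gt0.
have [E HE] : exists E, forall K, \sum_(k < K) digit_spread A D k.+1 <= E.
  have [E HE] := orbit_vector_sums_bounded (digits D) M1.
  exists E => K; apply: le_trans (HE K.+1); rewrite big_ord_recl lerDr.
  by rewrite !sumr_ge0// => v _; rewrite sumr_ge0.
have upper rho : exists c : 'I_n.+1 -> R, forall i k,
    count_le (X i) (image_box A k rho) (c i * delta ^+ k).
  suff /choice[c cP] : forall i, exists c, forall k,
      count_le (X i) (image_box A k rho) (c * delta ^+ k) by exists c.
  move=> i; have [Xi _] := XD i.
  have [c cP] := discrete_count_upper rho (ltW B0) Xi; exists c => k.
  by have := cP _ (MB k) (detM0 k); rewrite detM invrK.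
have [rho [c [c0 lower]]] : exists rho, exists c : 'I_n.+1 -> R, (forall i, 0 < c i) /\
    forall i k, count_ge (X i) (image_box A k rho) (c i * delta ^+ k).
  have /choice[rc rcP] : forall i, exists rc : R * R, [/\ 0 <= rc.1, 0 < rc.2 &
      forall k, count_ge (X i) (image_box A k rc.1) (rc.2 * delta ^+ k)].
    move=> i; have [_ Xi] := XD i.
    have [rho [c [rho0 c0 cP]]] := dense_count_lower B0 Xi.
    exists (rho, c); split => // k.
    by have := cP _ (MB k) (detM0 k); rewrite detM invrK.
  exists (\sum_i (rc i).1), (fun i => (rc i).2); split=> [i|i k].
    by case: (rcP i).
  have [_ _ /(_ k)] := rcP i; apply: count_ge_sub => x xi a.
  rewrite (le_trans (xi a))// (bigD1 i)//= lerDl sumr_ge0// => j _.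
  by case: (rcP j).
have pos_sum (f : 'I_n.+1 -> R) : (forall i, 0 < f i) -> 0 < \sum_i p 0 i * f i.
  move=> f0; rewrite big_ord_recl ltr_pwDl ?mulr_gt0// sumr_ge0// => i _.
  by rewrite mulr_ge0// ltW.
have weigh (f g : 'I_n.+1 -> R) : (forall i, f i <= g i) ->
    \sum_i p 0 i * f i <= \sum_i p 0 i * g i.
  by move=> fg; rewrite ler_sum// => i _; rewrite ler_wpM2l// ltW.
have scale (f : 'I_n.+1 -> R) x : \sum_i p 0 i * (f i * x) = (\sum_i p 0 i * f i) * x.
  by rewrite mulr_suml; apply: eq_bigr => i _; rewrite mulrA.
have col_sum (f : 'I_n.+1 -> R) k : l ^+ k * \sum_i p 0 i * f i =
    \sum_i p 0 i * (subdivision_mx D ^+ k *m \col_i f i) i 0.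
  rewrite (perron_weighted_power _ _ pS); congr (_ * _).
  by apply: eq_bigr => i _; rewrite mxE.
apply/eqP; rewrite eq_le; apply/andP; split.
(* Counts below on level 0, inflated, against the discreteness bound on level k. *)
- have [c' up] := upper (rho + E).
  apply: (@growth_rate_le _ (\sum_i p 0 i * c i) (\sum_i p 0 i * c' i)) => //.
    exact: pos_sum.
  move=> k; rewrite mulrC col_sum -scale; apply: weigh => i.
  apply: count_ge_le (up i k); apply: (count_ge_iter Au Xfix) => j; rewrite mxE.
  have := lower j 0%N; rewrite expr0 mulr1; apply: count_ge_sub => x xr a.
  by apply: le_trans (xr a) _; rewrite -addrA lerDl subr_ge0.
(* Density on level k against the inflated upper bound on level 0. *)
- have [c' up] := upper (rho + E).
  apply: (@growth_rate_le _ (\sum_i p 0 i * c i) (\sum_i p 0 i * c' i)) => //.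
    exact: pos_sum.
  move=> k; rewrite [leRHS]mulrC col_sum -scale; apply: weigh => i.
  apply: count_ge_le (lower i k) _; apply: (count_le_iter Au Xfix) => j; rewrite mxE.
  have := up j 0%N; rewrite expr0 mulr1; apply: count_le_sub => x xr a.
  by apply: le_trans (xr a) _; rewrite lerD2l.
Qed.

Theorem theorem2p3 (R : realType) (d n : nat) (d_gt0 : (0 < d)%N)
    (n_gt0 : (0 < n)%N) (A : 'M[R]_d) (A_expanding : expanding A)
    (D : 'I_n -> 'I_n -> {fset 'cV[R]_d})
    (S_primitive : primitive_mx (subdivision_mx D))
    (X_exists : exists X : 'I_n -> multiset R d, weak_Delone_family A D X) :
  perron_eigenvalue (subdivision_mx D) = `|\det A|.
Proof.
case: d d_gt0 A A_expanding D S_primitive X_exists => // d _ A Aexp.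
case: n n_gt0 => // n _ D Sprim [X XD].
have [l [p Sl [p0 pS]]] := perron_frobenius Sprim.
rewrite (perron_eigenvalueE Sl).
by apply: growth_of_inflation Aexp XD _ p0 pS; case: Sl.
Qed.
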